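(* Let $S_0$ be a positive semidefinite $d\times d$ complex matrix, let $\mathbf a=(a_i)_{i\in\mathbb I_k}$ with $a_1\ge\cdots\ge a_k>0$, and consider the frame operator distance $\Theta_2:\mathbb T_{\mathbb C^d}(\mathbf a)\to[0,\infty)$ given by $\Theta_2(\mathcal G)=\|S_0-S_{\mathcal G}\|_2$. Then the local minimizers of $\Theta_2$ in $\mathbb T_{\mathbb C^d}(\mathbf a)$ are also global minimizers.
   Context: $\mathbb I_k=\{1,\dots,k\}$. $\mathbb T_{\mathbb C^d}(\mathbf a)=\{\mathcal G=\{g_i\}_{i\in\mathbb I_k}\in(\mathbb C^d)^k:\ \|g_i\|^2=a_i,\ i\in\mathbb I_k\}$, endowed with the metric $d(\mathcal G,\tilde{\mathcal G})=\max\{\|g_i-\tilde g_i\|:i\in\mathbb I_k\}$. The frame operator of $\mathcal G=\{g_i\}_{i\in\mathbb I_k}$ is $S_{\mathcal G}=\sum_{i\in\mathbb I_k}g_i\otimes g_i$, where $(x\otimes y)z=\langle z,y\rangle x$. $\|A\|_2=\operatorname{tr}(A^*A)^{1/2}$ is the Frobenius norm. No relation between $k$ and $d$, nor between $\mathbf a$ and the spectrum of $S_0$, is assumed. *)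

(* Defs.v *)
From mathcomp Require Import all_boot all_order all_algebra.
From mathcomp Require Import complex reals.

Set Implicit Arguments.
Unset Strict Implicit.
Unset Printing Implicit Defensive.

Import Order.TTheory GRing.Theory Num.Theory.
Local Open Scope ring_scope.

Section FrameOperatorDistance.
Variable R : rcfType.
Local Notation C := R[i].

Definition adjmx (m n : nat) (A : 'M[C]_(m, n)) : 'M[C]_(n, m) :=
  (A ^t*)%sesqui.

(* Linear in the first argument, conjugate-linear in the second. *)
Definition cdot (d : nat) (x y : 'cV[C]_d) : C :=
  \sum_(j < d) x j 0 * (y j 0)^*.

(* [cdot x x] is a nonnegative real element of [C], so taking its real part
   only changes its type. *)
Definition cnorm (d : nat) (x : 'cV[C]_d) : R :=
  Num.sqrt (complex.Re (cdot x x)).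

(* The matrix of the operator z |-> <z, y> x. *)
Definition outer (d : nat) (x y : 'cV[C]_d) : 'M[C]_d := x *m adjmx y.

Lemma outerE (d : nat) (x y z : 'cV[C]_d) : outer x y *m z = cdot z y *: x.
Proof.
apply/matrixP => i j; rewrite !ord1 -mulmxA !mxE big_ord1 !mxE mulrC.
by congr (_ * _); apply: eq_bigr => l _; rewrite !mxE mulrC.
Qed.

(* In the partial order of [C], [0 <= c] says that c is real and
   nonnegative. *)
Definition psdmx (d : nat) (A : 'M[C]_d) : Prop :=
  adjmx A = A /\ forall z : 'cV[C]_d, 0 <= cdot (A *m z) z.

(* tr (A^* A) is a nonnegative real element of [C]. *)
Definition frobenius (d : nat) (A : 'M[C]_d) : R :=
  Num.sqrt (complex.Re (\tr (adjmx A *m A))).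

Definition in_torus (d k : nat) (a : 'I_k -> R) (G : 'I_k -> 'cV[C]_d) : Prop :=
  forall i, cnorm (G i) ^+ 2 = a i.

(* The norms are nonnegative, so 0 as the default value of the maximum is only
   seen when k = 0. *)
Definition frame_dist (d k : nat) (G H : 'I_k -> 'cV[C]_d) : R :=
  \big[Num.max/0]_(i < k) cnorm (G i - H i).

Definition frame_op (d k : nat) (G : 'I_k -> 'cV[C]_d) : 'M[C]_d :=
  \sum_(i < k) outer (G i) (G i).

Definition Theta2 (d k : nat) (S0 : 'M[C]_d) (G : 'I_k -> 'cV[C]_d) : R :=
  frobenius (S0 - frame_op G).

Definition local_minimizer (d k : nat) (a : 'I_k -> R)
    (F : ('I_k -> 'cV[C]_d) -> R) (G : 'I_k -> 'cV[C]_d) : Prop :=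
  in_torus a G /\
  exists2 eps : R, 0 < eps &
    forall H : 'I_k -> 'cV[C]_d,
      in_torus a H -> frame_dist G H < eps -> F G <= F H.

Definition global_minimizer (d k : nat) (a : 'I_k -> R)
    (F : ('I_k -> 'cV[C]_d) -> R) (G : 'I_k -> 'cV[C]_d) : Prop :=
  in_torus a G /\
  forall H : 'I_k -> 'cV[C]_d, in_torus a H -> F G <= F H.

End FrameOperatorDistance.

(* Main.v *)
Require Import Defs.
From mathcomp Require Import all_boot all_order all_algebra.
From mathcomp Require Import fingroup perm.
From mathcomp Require Import complex reals.
From mathcomp Require Import ring lra.
Local Open Scope ring_scope.

(** Write [D = S0 - frame_op G] for the residual at a local minimizer [G].  The
    torus is not convex and neither is its set of frame operators, but the
    problem becomes convex once it is read on ordered spectra, and local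
    minimality is exactly strong enough to give the first order optimality
    condition of that convex problem.

    Reading on spectra.  Let [H] be any point of the torus, let [nu] be the
    decreasing spectrum of its frame operator and [lambda] that of [S0].  The
    inner product of [S0] with the frame operator of [H] is at most
    [\sum_l lambda l * nu l] ([trace_product_le], von Neumann), hence the squared
    distance at [H] is at least [\sum_l (lambda l - nu l) ^+ 2].  The prescribed
    norms enter through one half of the Schur-Horn theorem
    ([partial_norms_le]): the sum of any [j] of the numbers [a i] is at most the
    sum of the [j] largest eigenvalues of [frame_op H].  Suppose that [S0] and
    [frame_op G] are diagonal in one basis with decreasing spectra [lambda] and
    [mu].  Then the squared distance at [G] is [\sum_l delta l ^+ 2] with
    [delta = lambda - mu] the spectrum of [D], and by expanding the square it
    suffices to show that [\sum_l delta l * (nu l - mu l) <= 0].  Summation by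
    parts ([partial_sums_le]) reduces this to a sign condition at each pair of
    consecutive indices.

    Local minimality.  Differentiating twice along curves in the torus gives
    [D *m G i = c i *: G i] ([critical]) and an inequality for every tangent
    direction ([second_order]).  The first makes [S0] and [frame_op G] commute.
    Three facts follow from the second.  A rotation of the whole frame in a
    plane spanned by two eigenvectors shows that the two spectra can be put in
    decreasing order simultaneously ([spectra_aligned]).  Turning by different
    angles the vectors of two eigenspaces of [D] shows that [delta] cannot
    decrease along the ordering as long as [mu] is positive
    ([residual_eigenvalue_order]).  Finally, a linear dependence among the vectors
    [G i] leaves a direction in which [frame_op G] does not move to first order,
    so that the vectors involved must lie in the top eigenspace of [D]
    ([dependent_level_max]).

    Sign condition.  Where [delta] drops, [mu] vanishes after the drop, so the
    partial sum of [mu] is the whole trace and dominates that of [nu]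
    ([falling_step]).  Where [delta] rises from index [i] to [i.+1], the vectors
    with [c t <= delta i] are independent because they do not belong to the top
    eigenspace.  So there are at most [i.+1] of them, they account for the whole
    partial sum of [mu], and the half of Schur-Horn quoted above bounds this sum
    by that of [nu] ([rising_step]). *)

Set Implicit Arguments.
Unset Strict Implicit.
Unset Printing Implicit Defensive.

Import Order.TTheory GRing.Theory Num.Theory.

Section LocalMinimizers.
Variable R : rcfType.
Local Notation C := R[i].
Local Notation Re := complex.Re.
Local Notation "x %:C" := (real_complex R x) : ring_scope.

(** * Real parts and squared moduli *)

Lemma ReD (x y : C) : Re (x + y) = Re x + Re y.
Proof. by case: x; case: y. Qed.

Lemma ReN (x : C) : Re (- x) = - Re x.
Proof. by case: x. Qed.

Lemma Re_sum (I : Type) (r : seq I) (P : pred I) (F : I -> C) :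
  Re (\sum_(i <- r | P i) F i) = \sum_(i <- r | P i) Re (F i).
Proof.
have Re0 : Re 0 = 0 by [].
by elim/big_rec2: _ => // i y x _ <-; rewrite ReD.
Qed.

Lemma ReZ (r : R) (x : C) : Re (r%:C * x) = r * Re x.
Proof. by case: x => a b /=; rewrite mul0r subr0. Qed.

Lemma complexRe_conj (x : C) : Re (x^*) = Re x.
Proof. by case: x. Qed.

Lemma conj_real (r : R) : (r%:C)^* = r%:C.
Proof. by apply/eqP; rewrite eq_complex /= oppr0 !eqxx. Qed.

Definition nsq (z : C) : R := Re (z * z^*).

Lemma nsqE (z : C) : nsq z = Re z ^+ 2 + complex.Im z ^+ 2.
Proof. by case: z => a b; rewrite /nsq /= mulrN opprK !expr2. Qed.

Lemma nsqC (z : C) : (nsq z)%:C = z * z^*.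
Proof.
apply/eqP; rewrite eq_complex /nsq; case: z => a b /=.
by apply/andP; split => //; apply/eqP; ring.
Qed.

Lemma nsq_ge0 (z : C) : 0 <= nsq z.
Proof. by rewrite nsqE addr_ge0 ?sqr_ge0. Qed.

Lemma nsq_eq0 (z : C) : (nsq z == 0) = (z == 0).
Proof.
by rewrite nsqE paddr_eq0 ?sqr_ge0 // !sqrf_eq0 eq_complex.
Qed.

Lemma nsq_conj (z : C) : nsq (z^*) = nsq z.
Proof. by rewrite /nsq conjCK mulrC. Qed.

Lemma nsqM (z w : C) : nsq (z * w) = nsq z * nsq w.
Proof. by rewrite !nsqE; case: z => a b; case: w => c d /=; ring. Qed.

Lemma nsqN (z : C) : nsq (- z) = nsq z.
Proof. by rewrite /nsq rmorphN mulrNN. Qed.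

Lemma nsq_real (r : R) : nsq r%:C = r ^+ 2.
Proof. by rewrite nsqE /= expr0n addr0. Qed.

Section Cdot.
Variable d : nat.
Implicit Types (x y z : 'cV[C]_d) (A B : 'M[C]_d).

Lemma cdotE x y : cdot x y = (adjmx y *m x) 0 0.
Proof. by rewrite mxE; apply: eq_bigr => j _; rewrite !mxE mulrC. Qed.

Lemma cdotC x y : cdot y x = (cdot x y)^*.
Proof.
by rewrite /cdot rmorph_sum; apply: eq_bigr => j _; rewrite rmorphM /= conjCK mulrC.
Qed.

Lemma cdotDl x y z : cdot (x + y) z = cdot x z + cdot y z.
Proof. by rewrite !cdotE mulmxDr mxE. Qed.

Lemma cdotZl (c : C) x z : cdot (c *: x) z = c * cdot x z.
Proof. by rewrite !cdotE -scalemxAr mxE. Qed.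

Lemma cdot_suml (I : Type) (r : seq I) (P : pred I) (F : I -> 'cV[C]_d) z :
  cdot (\sum_(i <- r | P i) F i) z = \sum_(i <- r | P i) cdot (F i) z.
Proof. by rewrite cdotE mulmx_sumr summxE; apply: eq_bigr => i _; rewrite cdotE. Qed.

Lemma cdotDr x y z : cdot z (x + y) = cdot z x + cdot z y.
Proof. by rewrite cdotC cdotDl rmorphD /= -!cdotC. Qed.

Lemma cdotZr (c : C) x z : cdot z (c *: x) = c^* * cdot z x.
Proof. by rewrite cdotC cdotZl rmorphM /= -cdotC. Qed.

Lemma cdot0l z : cdot 0 z = 0.
Proof. by rewrite cdotE mulmx0 mxE. Qed.

Lemma adjmxK (m n : nat) (A : 'M[C]_(m, n)) : adjmx (adjmx A) = A.
Proof. exact: trmxCK. Qed.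

Lemma adjmxM (m n p : nat) (A : 'M[C]_(m, n)) (B : 'M[C]_(n, p)) :
  adjmx (A *m B) = adjmx B *m adjmx A.
Proof. by rewrite /adjmx trmx_mul map_mxM. Qed.

Lemma cdot_adj A x y : cdot (A *m x) y = cdot x (adjmx A *m y).
Proof. by rewrite !cdotE adjmxM adjmxK mulmxA. Qed.

Definition rdot x y : R := Re (cdot x y).

Lemma rdotC x y : rdot x y = rdot y x.
Proof. by rewrite /rdot cdotC complexRe_conj. Qed.

Lemma rdotDl x y z : rdot (x + y) z = rdot x z + rdot y z.
Proof. by rewrite /rdot cdotDl ReD. Qed.

Lemma rdotZl (r : R) x z : rdot (r%:C *: x) z = r * rdot x z.
Proof. by rewrite /rdot cdotZl ReZ. Qed.

Lemma rdotDr x y z : rdot z (x + y) = rdot z x + rdot z y.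
Proof. by rewrite rdotC rdotDl !(rdotC z). Qed.

Lemma rdotZr (r : R) x z : rdot z (r%:C *: x) = r * rdot z x.
Proof. by rewrite rdotC rdotZl rdotC. Qed.

Lemma rdotxx x : rdot x x = \sum_j nsq (x j 0).
Proof. by rewrite /rdot /cdot Re_sum. Qed.

Lemma rdot_ge0 x : 0 <= rdot x x.
Proof. by rewrite rdotxx sumr_ge0 // => j _; rewrite nsq_ge0. Qed.

Lemma rdot_eq0 x : rdot x x = 0 -> x = 0.
Proof.
rewrite rdotxx => /eqP; rewrite psumr_eq0 => [/allP h|j _]; last exact: nsq_ge0.
apply/colP => j; rewrite mxE; apply/eqP; rewrite -nsq_eq0.
by have := h j (mem_index_enum _).
Qed.

Lemma cnorm_sqr x : cnorm x ^+ 2 = rdot x x.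
Proof. by rewrite /cnorm sqr_sqrtr // rdot_ge0. Qed.

End Cdot.

(** * The real inner product of matrices *)

Section Matrices.
Variable d : nat.
Implicit Types (x y z : 'cV[C]_d) (A B D : 'M[C]_d).

(** The real inner product whose norm is the Frobenius norm; all second order
    expansions take place in this Euclidean space. *)
Definition ip A B : R := Re (\tr (adjmx A *m B)).

Lemma ipE A B : ip A B =
  \sum_j \sum_i (Re (A i j)^* * Re (B i j) - complex.Im (A i j)^* * complex.Im (B i j)).
Proof.
rewrite /ip /mxtrace Re_sum; apply: eq_bigr => j _; rewrite mxE Re_sum.
by apply: eq_bigr => i _; rewrite !mxE; case: (A i j); case: (B i j).
Qed.

Lemma ipC A B : ip A B = ip B A.
Proof.
rewrite !ipE; apply: eq_bigr => j _; apply: eq_bigr => i _.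
by case: (A i j) => a a'; case: (B i j) => b b' /=; ring.
Qed.

Lemma ipDr A B D : ip A (B + D) = ip A B + ip A D.
Proof. by rewrite /ip mulmxDr mxtraceD ReD. Qed.

Lemma ipZr (r : R) A B : ip A (r%:C *: B) = r * ip A B.
Proof. by rewrite /ip -scalemxAr mxtraceZ ReZ. Qed.

Lemma ipDl A B D : ip (B + D) A = ip B A + ip D A.
Proof. by rewrite ipC ipDr !(ipC A). Qed.

Lemma ipZl (r : R) A B : ip (r%:C *: B) A = r * ip B A.
Proof. by rewrite ipC ipZr ipC. Qed.

Lemma ipNr A B : ip A (- B) = - ip A B.
Proof. by rewrite /ip mulmxN raddfN /= ReN. Qed.

Lemma ipNl A B : ip (- B) A = - ip B A.
Proof. by rewrite ipC ipNr ipC. Qed.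

Lemma ip_sumr (I : Type) (r : seq I) (P : pred I) (F : I -> 'M[C]_d) A :
  ip A (\sum_(i <- r | P i) F i) = \sum_(i <- r | P i) ip A (F i).
Proof.
apply: (big_morph (ip A)) => [B D|]; first exact: ipDr.
by rewrite /ip mulmx0 mxtrace0.
Qed.

Lemma ip_suml (I : Type) (r : seq I) (P : pred I) (F : I -> 'M[C]_d) A :
  ip (\sum_(i <- r | P i) F i) A = \sum_(i <- r | P i) ip (F i) A.
Proof. by rewrite ipC ip_sumr; apply: eq_bigr => i _; rewrite ipC. Qed.

Lemma ip_ge0 A : 0 <= ip A A.
Proof.
rewrite ipE sumr_ge0 // => j _; rewrite sumr_ge0 // => i _.
by case: (A i j) => a b /=; rewrite mulNr opprK -!expr2 addr_ge0 ?sqr_ge0.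
Qed.

Lemma ip_AMGM A B : 2 * `|ip A B| <= ip A A + ip B B.
Proof.
have h1 := ip_ge0 (A + B); have h2 := ip_ge0 (A - B).
rewrite !(ipDl, ipDr, ipNl, ipNr) (ipC B A) in h1 h2.
by move: (ip A A) (ip A B) (ip B B) h1 h2 => p q r; case: (ger0P q) => _; lra.
Qed.

Lemma outerDl x y z : outer (x + y) z = outer x z + outer y z.
Proof. by rewrite /outer mulmxDl. Qed.

Lemma outerDr x y z : outer z (x + y) = outer z x + outer z y.
Proof. by rewrite /outer /adjmx linearD /= map_mxD mulmxDr. Qed.

Lemma outerZl (c : C) x z : outer (c *: x) z = c *: outer x z.
Proof. by rewrite /outer scalemxAl. Qed.

Lemma outerZr (c : C) x z : outer z (c *: x) = c^* *: outer z x.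
Proof. by rewrite /outer /adjmx linearZ /= map_mxZ -scalemxAr. Qed.

Lemma outer_sumr (I : Type) (r : seq I) (P : pred I) (F : I -> 'cV[C]_d) z :
  outer z (\sum_(i <- r | P i) F i) = \sum_(i <- r | P i) outer z (F i).
Proof.
apply: (big_morph (outer z)) => [x y|]; first exact: outerDr.
by rewrite /outer /adjmx trmx0 map_mx0 mulmx0.
Qed.

Lemma adj_outer x y : adjmx (outer x y) = outer y x.
Proof. by rewrite /outer adjmxM adjmxK. Qed.

Lemma mul_outer A x y : A *m outer x y = outer (A *m x) y.
Proof. by rewrite /outer mulmxA. Qed.

Lemma outer_mul A x y : outer x y *m A = outer x (adjmx A *m y).
Proof. by rewrite /outer adjmxM adjmxK mulmxA. Qed.

Lemma ip_outer A x y : ip A (outer x y) = rdot x (A *m y).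
Proof.
by rewrite /ip /outer mulmxA mxtrace_mulC mulmxA -adjmxM trace_mx11 -cdotE.
Qed.

Lemma herm_rdot D x y : adjmx D = D -> rdot (D *m x) y = rdot x (D *m y).
Proof. by move=> hD; rewrite /rdot cdot_adj hD. Qed.

Lemma adjmxD A B : adjmx (A + B) = adjmx A + adjmx B.
Proof. by rewrite /adjmx linearD /= map_mxD. Qed.

Lemma adjmxN A : adjmx (- A) = - adjmx A.
Proof. by rewrite /adjmx linearN /= map_mxN. Qed.

Lemma adjmxZ (c : C) A : adjmx (c *: A) = c^* *: adjmx A.
Proof. by rewrite /adjmx linearZ /= map_mxZ. Qed.

Lemma adjmx_sum (I : Type) (r : seq I) (P : pred I) (F : I -> 'M[C]_d) :
  adjmx (\sum_(i <- r | P i) F i) = \sum_(i <- r | P i) adjmx (F i).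
Proof.
apply: (big_morph (@adjmx R d d)); first exact: adjmxD.
by rewrite /adjmx trmx0 map_mx0.
Qed.

Variable k : nat.
Implicit Types G H h : 'I_k -> 'cV[C]_d.

Lemma frame_op_herm G : adjmx (frame_op G) = frame_op G.
Proof. by rewrite adjmx_sum; apply: eq_bigr => i _; rewrite adj_outer. Qed.

Lemma frame_opE G x : frame_op G *m x = \sum_i cdot x (G i) *: G i.
Proof. by rewrite mulmx_suml; apply: eq_bigr => i _; rewrite outerE. Qed.

(** The derivative of [frame_op] at [G] in the direction [h]. *)
Definition frame_var G h : 'M[C]_d :=
  \sum_i (outer (h i) (G i) + outer (G i) (h i)).

Lemma ip_frame_var D G h : adjmx D = D ->
  ip D (frame_var G h) = 2 * \sum_i rdot (D *m G i) (h i).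
Proof.
move=> hD; rewrite ip_sumr mulr_sumr; apply: eq_bigr => i _.
by rewrite ipDr !ip_outer (rdotC (h i)) -(herm_rdot (G i) (h i) hD); ring.
Qed.

Lemma frame_varN G h : frame_var G (fun i => - h i) = - frame_var G h.
Proof.
rewrite /frame_var -sumrN; apply: eq_bigr => i _.
by rewrite -scaleN1r outerZl outerZr rmorphN1 !scaleN1r opprD.
Qed.

Lemma ip_expand (s t : R) D A B :
  let E := D - s%:C *: A - t%:C *: B in
  ip E E = ip D D - 2 * s * ip D A + s ^+ 2 * ip A A - 2 * t * ip D B
           + 2 * s * t * ip A B + t ^+ 2 * ip B B.
Proof.
rewrite /= !(ipDl, ipDr, ipNl, ipNr, ipZl, ipZr) (ipC A D) (ipC B D) (ipC B A).
move: (ip D D) (ip D A) (ip D B) (ip A A) (ip A B) (ip B B) => *; ring.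
Qed.

(** The coefficient [1 - s ^+ 2 * psi] is chosen later so that the curve stays on
    the torus, which forces its square to be [1 - s ^+ 2 * b].  This makes the
    second order term exact, up to a multiple of [s] that only involves the
    first order matrices. *)
Lemma frame_op_path G h (s : R) (b psi : 'I_k -> R) :
    (forall i, b i = 2 * psi i - s ^+ 2 * psi i ^+ 2) ->
  frame_op (fun i => (1 - s ^+ 2 * psi i)%:C *: G i + s%:C *: h i) =
  frame_op G + s%:C *: frame_var G h +
  (s ^+ 2)%:C *: \sum_i (outer (h i) (h i) - (b i)%:C *: outer (G i) (G i)
         - (s * psi i)%:C *: (outer (h i) (G i) + outer (G i) (h i))).
Proof.
move=> hb; rewrite /frame_op /frame_var !scaler_sumr -!big_split /=.
apply: eq_bigr => i _.
rewrite !(outerDl, outerDr, outerZl, outerZr) !conj_real.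
move: (outer (G i) (G i)) (outer (h i) (h i)) => gg hh.
move: (outer (G i) (h i)) (outer (h i) (G i)) => gh hg.
apply/matrixP => u v; rewrite !mxE hb.
by move: (gg u v) (hh u v) (gh u v) (hg u v) => *; ring.
Qed.

End Matrices.

(** * Curves in the torus *)

(** The only passage to the limit: a bound [O(s)] on the error for small positive
    [s] is enough to read off the sign of a coefficient. *)
Lemma limit_ge0 (alpha K s0 : R) : 0 < s0 ->
  (forall s, 0 < s -> s <= s0 -> 0 <= alpha + s * K) -> 0 <= alpha.
Proof.
move=> s0_gt0 hs; rewrite leNgt; apply/negP => alpha_lt0.
have K1_gt0 : 0 < 2 * (`|K| + 1) by have := normr_ge0 K; lra.
set t := - alpha / (2 * (`|K| + 1)).
have t_gt0 : 0 < t by rewrite divr_gt0 ?oppr_gt0.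
have et : t * (`|K| + 1) = - alpha / 2.
  rewrite /t; field; lra.
set s := Num.min s0 t.
have s_gt0 : 0 < s by rewrite lt_min s0_gt0.
have st : s * (`|K| + 1) <= t * (`|K| + 1) by rewrite ler_wpM2r ?ge_min ?lexx ?orbT //; lra.
have sK : s * K <= s * `|K| by rewrite ler_wpM2l ?ler_norm // ltW.
have := hs s s_gt0; rewrite ge_min lexx => /(_ isT).
lra.
Qed.

(** This is [(1 - sqrt (1 - s ^+ 2 * b)) / s ^+ 2] after rationalizing the
    numerator, so that it also makes sense, and stays bounded, near [s = 0]. *)
Definition path_coef (b s : R) : R := b / (1 + Num.sqrt (1 - s ^+ 2 * b)).

Lemma path_coefP (b s : R) : 0 <= b -> s ^+ 2 * b <= 1 ->
  let p := path_coef b s in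
  [/\ 0 <= p, p <= b & b = 2 * p - s ^+ 2 * p ^+ 2].
Proof.
move=> b_ge0 sb; rewrite /path_coef.
set r := Num.sqrt _.
have r_ge0 : 0 <= r by exact: sqrtr_ge0.
have er : r ^+ 2 = 1 - s ^+ 2 * b by rewrite sqr_sqrtr // subr_ge0.
have r1 : 0 < 1 + r by lra.
split.
- by rewrite divr_ge0 // ltW.
- by rewrite ler_pdivrMr //; nra.
- have r1n : 1 + r != 0 by rewrite gt_eqF.
  have sb' : s ^+ 2 * b = (1 - r) * (1 + r) by lra.
  have -> : s ^+ 2 * (b / (1 + r)) ^+ 2 = (s ^+ 2 * b) * b / (1 + r) ^+ 2 by field.
  by rewrite sb'; field.
Qed.

Section Path.
Variables (d k : nat).
Implicit Types (a : 'I_k -> R) (G h : 'I_k -> 'cV[C]_d).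

(** The great circle through [G i] with initial velocity [h i], parametrized by
    the coefficient of [h i]. *)
Definition torus_path a G h (s : R) (i : 'I_k) : 'cV[C]_d :=
  (1 - s ^+ 2 * path_coef (rdot (h i) (h i) / a i) s)%:C *: G i + s%:C *: h i.

Lemma torus_pathP a G h s i : 0 < a i -> rdot (G i) (G i) = a i ->
    rdot (h i) (G i) = 0 -> s ^+ 2 * (rdot (h i) (h i) / a i) <= 1 ->
  rdot (torus_path a G h s i) (torus_path a G h s i) = a i /\
  rdot (G i - torus_path a G h s i) (G i - torus_path a G h s i)
    <= 2 * s ^+ 2 * rdot (h i) (h i).
Proof.
move=> ai_gt0 GG hG sb; rewrite /torus_path.
set b := rdot (h i) (h i) / a i in sb *.
have b_ge0 : 0 <= b by rewrite divr_ge0 ?rdot_ge0 // ltW.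
have [p_ge0 p_le hb] := path_coefP b_ge0 sb.
set p := path_coef b s in p_ge0 p_le hb *.
have hh : rdot (h i) (h i) = b * a i by rewrite /b divfK // gt_eqF.
have -> : G i - ((1 - s ^+ 2 * p)%:C *: G i + s%:C *: h i)
        = (s ^+ 2 * p)%:C *: G i + (- s)%:C *: h i.
  by apply/colP => j; rewrite !mxE; ring.
rewrite !(rdotDl, rdotDr, rdotZl, rdotZr) (rdotC (G i) (h i)) hG GG hh.
split.
  have -> : b * a i = (2 * p - s ^+ 2 * p ^+ 2) * a i by rewrite -hb.
  ring.
set L := (X in X <= _); have -> : L = s ^+ 2 * a i * (s ^+ 2 * p ^+ 2 + b).
  by rewrite /L; ring.
have -> : s ^+ 2 * p ^+ 2 + b = 2 * p by rewrite {1}hb; ring.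
have -> : 2 * s ^+ 2 * (b * a i) = s ^+ 2 * a i * (2 * b) by ring.
by rewrite ler_wpM2l ?ler_pM2l // mulr_ge0 ?sqr_ge0 // ltW.
Qed.

Lemma frame_dist_lt G H eps : 0 < eps ->
  (forall i, rdot (G i - H i) (G i - H i) < eps ^+ 2) -> frame_dist G H < eps.
Proof.
move=> eps_gt0 hGH; rewrite /frame_dist; elim/big_rec: _ => // i x _ hx.
rewrite gt_max hx andbT -(ltr_pXn2r (n := 2)) ?nnegrE ?(ltW eps_gt0) //.
  by rewrite cnorm_sqr.
exact: sqrtr_ge0.
Qed.

Lemma torus_path_near a G h eps : (forall i, 0 < a i) -> in_torus a G ->
    (forall i, rdot (h i) (G i) = 0) -> 0 < eps ->
  exists2 s0 : R, 0 < s0 <= 1 & forall s, 0 < s -> s <= s0 ->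
    [/\ in_torus a (torus_path a G h s), frame_dist G (torus_path a G h s) < eps
      & forall i, s ^+ 2 * (rdot (h i) (h i) / a i) <= 1].
Proof.
move=> a_gt0 Ga hG eps_gt0.
pose K := \sum_i (rdot (h i) (h i) / a i + 2 * rdot (h i) (h i)).
have b_ge0 i : 0 <= rdot (h i) (h i) / a i by rewrite divr_ge0 ?rdot_ge0 // ltW.
have K_ge i : rdot (h i) (h i) / a i + 2 * rdot (h i) (h i) <= K.
  rewrite /K (bigD1 i) //= lerDl sumr_ge0 // => j _.
  by rewrite addr_ge0 // mulr_ge0 ?rdot_ge0.
have K_ge0 : 0 <= K.
  by rewrite sumr_ge0 // => j _; rewrite addr_ge0 // mulr_ge0 ?rdot_ge0.
pose e := Num.min 1 (eps ^+ 2).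
have e_gt0 : 0 < e by rewrite lt_min ltr01 exprn_gt0.
have e_le1 : e <= 1 by rewrite ge_min lexx.
have e_lee : e <= eps ^+ 2 by rewrite ge_min lexx orbT.
have K1_gt0 : 0 < 1 + K by lra.
exists (e / (1 + K)).
  by rewrite divr_gt0 //= ler_pdivrMr //; lra.
move=> s s_gt0; rewrite ler_pdivlMr // => s_le.
have sK_ge0 : 0 <= s * K by rewrite mulr_ge0 // ltW.
have s_le1 : s <= 1 by lra.
have s2K : s ^+ 2 * K < e.
  apply: (@le_lt_trans _ _ (s * K)); last by lra.
  by rewrite expr2 -mulrA ler_piMl.
have s2i i : s ^+ 2 * (rdot (h i) (h i) / a i + 2 * rdot (h i) (h i)) < e.
  by apply: le_lt_trans s2K; rewrite ler_wpM2l ?sqr_ge0.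
have sb i : s ^+ 2 * (rdot (h i) (h i) / a i) <= 1.
  apply: le_trans e_le1; apply: le_trans (ltW (s2i i)).
  by rewrite ler_wpM2l ?sqr_ge0 // lerDl mulr_ge0 ?rdot_ge0.
split=> // [i|].
  by rewrite cnorm_sqr; case: (torus_pathP (a_gt0 i) _ (hG i) (sb i)); rewrite -?cnorm_sqr.
apply: frame_dist_lt => // i.
case: (torus_pathP (a_gt0 i) _ (hG i) (sb i)); first by rewrite -cnorm_sqr.
move=> _ /le_lt_trans; apply; apply: lt_le_trans e_lee; apply: le_lt_trans (s2i i).
by rewrite (mulrC 2) -mulrA ler_wpM2l ?sqr_ge0 // lerDr.
Qed.
End Path.

(** * First and second order conditions at a local minimizer *)

Lemma Theta2_le (d k : nat) (S0 : 'M[C]_d) (G H : 'I_k -> 'cV[C]_d) :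
  (Theta2 S0 G <= Theta2 S0 H) =
  (ip (S0 - frame_op G) (S0 - frame_op G) <= ip (S0 - frame_op H) (S0 - frame_op H)).
Proof.
rewrite /Theta2 /frobenius -!/(ip _ _) -(ler_pXn2r (n := 2)) ?nnegrE ?sqrtr_ge0 //.
by rewrite (sqr_sqrtr (ip_ge0 _)) (sqr_sqrtr (ip_ge0 _)).
Qed.

(** Only boundedness of the error term matters, hence this crude estimate. *)
Lemma ip_sum_bounded (d : nat) (I : finType) (t b : I -> R) (A : I -> 'M[C]_d) :
    (forall i, 0 <= t i <= b i) ->
  ip (\sum_i (t i)%:C *: A i) (\sum_i (t i)%:C *: A i)
    <= \sum_i \sum_j b i * b j * `|ip (A i) (A j)|.
Proof.
move=> tb; rewrite ip_suml ler_sum // => i _; rewrite ip_sumr ler_sum // => j _.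
rewrite ipZl ipZr mulrA.
have /andP[ti tbi] := tb i; have /andP[tj tbj] := tb j.
apply: (@le_trans _ _ (t i * t j * `|ip (A i) (A j)|)).
  by rewrite ler_wpM2l ?ler_norm // mulr_ge0.
by rewrite ler_wpM2r // ler_pM.
Qed.

(** The expansion of the squared distance, divided by [2 * s]: everything beyond the
    first order coefficient [DA] is bounded by a constant times [s].  The names
    stand for inner products of the residual [D], the first order term [A] and
    the higher order term [X]. *)
Lemma first_order_bound (s DD DA DX AA AX XX K : R) :
    0 < s <= 1 -> 0 <= DD -> 0 <= AA -> 0 <= XX <= K ->
    2 * `|DX| <= DD + XX -> 2 * `|AX| <= AA + XX ->
    0 <= - 2 * s * DA + s ^+ 2 * AA - 2 * s ^+ 2 * DX
         + 2 * s * s ^+ 2 * AX + (s ^+ 2) ^+ 2 * XX ->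
  0 <= - DA + s * (DD + 2 * AA + 3 * K).
Proof.
move=> /andP[s_gt0 s_le1] D0 A0 /andP[X0 XK] DX' AX' pos.
have DXn := ler_norm (- DX); rewrite normrN in DXn.
have AXn := ler_norm AX.
rewrite -(pmulr_rge0 _ s_gt0).
have s2 : 0 <= s ^+ 2 by rewrite sqr_ge0.
have [s3 s3'] : 0 <= s * s ^+ 2 /\ s * s ^+ 2 <= s ^+ 2.
  by rewrite mulr_ge0 ?ler_piMl // ltW.
have [s4 s4'] : 0 <= (s ^+ 2) ^+ 2 /\ (s ^+ 2) ^+ 2 <= s ^+ 2.
  by rewrite sqr_ge0 (expr2 (s ^+ 2)) ler_piMl // expr_le1 // ltW.
have e1 : s ^+ 2 * (- DX * 2) <= s ^+ 2 * (DD + K) by rewrite ler_wpM2l //; lra.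
have e2 : s * s ^+ 2 * (2 * AX) <= s ^+ 2 * (AA + K).
  apply: (@le_trans _ _ (s * s ^+ 2 * (AA + K))); first by rewrite ler_wpM2l //; lra.
  by rewrite ler_wpM2r //; lra.
have e3 : (s ^+ 2) ^+ 2 * XX <= s ^+ 2 * K by rewrite ler_pM.
have e0 : 0 <= s ^+ 2 * (DD + 2 * AA + 3 * K) by rewrite mulr_ge0 //; lra.
lra.
Qed.

(** The same expansion once the first order coefficient is known to vanish,
    divided by [s ^+ 2]; [Q] stands for the inner product of [D] with [X]. *)
Lemma second_order_bound (s Q AA AX XX K : R) :
    0 < s <= 1 -> 0 <= XX <= K -> 2 * `|AX| <= AA + XX ->
    0 <= s ^+ 2 * AA - 2 * s ^+ 2 * Q + 2 * s * s ^+ 2 * AX + (s ^+ 2) ^+ 2 * XX ->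
  0 <= AA - 2 * Q + s * (AA + 2 * K).
Proof.
move=> /andP[s_gt0 s_le1] /andP[X0 XK] AX' pos.
have AXn := ler_norm AX.
have s2 : 0 < s ^+ 2 by rewrite exprn_gt0.
rewrite -(pmulr_rge0 _ s2).
have e3 : s ^+ 2 * XX <= s * K.
  apply: (@le_trans _ _ (s * XX)); last by rewrite ler_wpM2l // ltW.
  by rewrite ler_wpM2r // expr2 ler_piMl // ltW.
have e4 : s * (2 * AX) <= s * (AA + K) by rewrite ler_wpM2l ?(ltW s_gt0) //; lra.
have : s ^+ 2 * (s * (2 * AX) + s ^+ 2 * XX) <= s ^+ 2 * (s * (AA + K) + s * K).
  by rewrite ler_pM2l // lerD.
lra.
Qed.

Section Local.
Variables (d k : nat) (S0 : 'M[C]_d) (a : 'I_k -> R) (G : 'I_k -> 'cV[C]_d).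
Hypothesis S0_herm : adjmx S0 = S0.
Hypothesis a_gt0 : forall i, 0 < a i.
Hypothesis G_min : local_minimizer a (Theta2 S0) G.

Let D : 'M[C]_d := S0 - frame_op G.

Lemma residual_herm : adjmx D = D.
Proof. by rewrite /D adjmxD adjmxN S0_herm frame_op_herm. Qed.

(** The matrix [X] collects all terms of order at least two in the frame operator
    along the curve.  It depends on [s] but stays bounded, and its inner product
    with [D] is independent of [s] as soon as every [D *m G i] is orthogonal to
    [h i]: the [s]-dependent part of [X] is a combination of first order terms. *)
Lemma local_expansion (h : 'I_k -> 'cV[C]_d) :
    (forall i, rdot (h i) (G i) = 0) ->
  exists s0 K : R, 0 < s0 <= 1 /\ forall s, 0 < s -> s <= s0 -> exists X : 'M[C]_d,
   [/\ ip X X <= K,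
       0 <= - 2 * s * ip D (frame_var G h)
            + s ^+ 2 * ip (frame_var G h) (frame_var G h) - 2 * s ^+ 2 * ip D X
            + 2 * s * s ^+ 2 * ip (frame_var G h) X + (s ^+ 2) ^+ 2 * ip X X
     & (forall i, rdot (D *m G i) (h i) = 0) ->
       ip D X = \sum_i (rdot (D *m h i) (h i)
                        - rdot (h i) (h i) / a i * rdot (D *m G i) (G i))].
Proof.
move=> hG; have [Ga [eps eps_gt0 G_le]] := G_min.
have [s0 s01 near_s0] := torus_path_near a_gt0 Ga hG eps_gt0.
pose b i := rdot (h i) (h i) / a i.
have b_ge0 i : 0 <= b i by rewrite divr_ge0 ?rdot_ge0 // ltW.
pose B := \sum_i (outer (h i) (h i) - (b i)%:C *: outer (G i) (G i)).
pose A i := outer (h i) (G i) + outer (G i) (h i).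
exists s0, (2 * ip B B + 2 * \sum_i \sum_j b i * b j * `|ip (A i) (A j)|).
split=> // s s_gt0 s_le; have [Ht Hd sb] := near_s0 s s_gt0 s_le.
have s_le1 : s <= 1 by apply: le_trans s_le _; case/andP: s01.
pose psi i := path_coef (b i) s.
have psiP i : [/\ 0 <= psi i, psi i <= b i & b i = 2 * psi i - s ^+ 2 * psi i ^+ 2].
  exact: (path_coefP (b_ge0 i) (sb i)).
pose W := \sum_i (s * psi i)%:C *: A i.
have XE : \sum_i (outer (h i) (h i) - (b i)%:C *: outer (G i) (G i)
         - (s * psi i)%:C *: (outer (h i) (G i) + outer (G i) (h i))) = B - W.
  by rewrite /B /W -sumrB.
exists (B - W); split.
- have W_le : ip W W <= \sum_i \sum_j b i * b j * `|ip (A i) (A j)|.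
    apply: ip_sum_bounded => i; have [p0 pb _] := psiP i.
    rewrite mulr_ge0 ?(ltW s_gt0) //=; apply: le_trans pb.
    by rewrite ler_piMl.
  have := ip_ge0 (B + W); rewrite !(ipDl, ipDr, ipNl, ipNr) (ipC W B).
  by move: (ip B B) (ip B W) (ip W W) W_le => BB BW WW; lra.
- have := G_le _ Ht Hd; rewrite Theta2_le -/D.
  rewrite (frame_op_path G h (b := b) (psi := psi)) => [|i]; last by case: (psiP i).
  rewrite XE !opprD !addrA -/D ip_expand.
  move: (ip (B - W) (B - W)) (ip _ (B - W)) (ip D (B - W)) => XX AX DX.
  move: (ip _ (frame_var G h)) (ip D (frame_var G h)) (ip D D) => AA DA DD.
  lra.
- move=> Dh; have DW : ip D W = 0.
    rewrite ip_sumr big1 // => i _.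
    rewrite ipZr /A ipDr !ip_outer (rdotC (h i)) -(herm_rdot _ _ residual_herm) Dh.
    by rewrite addr0 mulr0.
  rewrite ipDr ipNr DW subr0 ip_sumr; apply: eq_bigr => i _.
  by rewrite ipDr ipNr ipZr !ip_outer !(rdotC _ (D *m _)).
Qed.

(** The direction [- h] is tangent as well, so the derivative vanishes. *)
Lemma first_order (h : 'I_k -> 'cV[C]_d) :
  (forall i, rdot (h i) (G i) = 0) -> ip D (frame_var G h) = 0.
Proof.
have half h' : (forall i, rdot (h' i) (G i) = 0) -> ip D (frame_var G h') <= 0.
  move=> hG; have [s0 [K [/andP[s0_gt0 s0_le1] exp_h]]] := local_expansion hG.
  set A := frame_var G h' in exp_h *.
  rewrite -oppr_ge0; apply: (@limit_ge0 _ (ip D D + 2 * ip A A + 3 * K) _ s0_gt0).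
  move=> s s_gt0 s_le; have [X [XK pos _]] := exp_h s s_gt0 s_le.
  by apply: first_order_bound pos; rewrite ?ip_ge0 ?ip_AMGM // s_gt0 (le_trans s_le).
move=> hG; apply/eqP; rewrite eq_le half //= -oppr_le0 -ipNr -frame_varN half //.
by move=> i; rewrite -scaleN1r /rdot cdotZl mulN1r ReN -/(rdot _ _) hG oppr0.
Qed.

(** Lagrange multipliers: the component of [D *m G i] orthogonal to [G i] is a
    tangent direction, along which the derivative is twice its squared norm. *)
Lemma critical i : D *m G i = (rdot (D *m G i) (G i) / a i)%:C *: G i.
Proof.
have [Ga _] := G_min.
have GG j : rdot (G j) (G j) = a j by rewrite -cnorm_sqr Ga.
pose c j := rdot (D *m G j) (G j) / a j.
pose h j := D *m G j + (- c j)%:C *: G j.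
have hG j : rdot (h j) (G j) = 0.
  by rewrite /h rdotDl rdotZl GG /c mulNr divfK ?subrr // gt_eqF.
have := first_order hG; rewrite (ip_frame_var _ _ residual_herm) => /eqP.
rewrite mulf_eq0 pnatr_eq0 /=.
have Dh j : rdot (D *m G j) (h j) = rdot (h j) (h j).
  by rewrite {2}/h rdotDl rdotZl (rdotC (G j)) hG mulr0 addr0.
rewrite (eq_bigr _ (fun j _ => Dh j)) psumr_eq0 => [|j _]; last exact: rdot_ge0.
move/allP/(_ i (mem_index_enum _)) => /eqP /rdot_eq0 /eqP.
by rewrite /h rmorphN scaleNr subr_eq0 => /eqP.
Qed.

(** The left side is the effect of the curvature of the torus and of [D], the right
    side that of the convex quadratic distance. *)
Lemma second_order (h : 'I_k -> 'cV[C]_d) :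
    (forall i, rdot (h i) (G i) = 0) ->
  2 * \sum_i (rdot (D *m h i) (h i) - rdot (D *m G i) (G i) / a i * rdot (h i) (h i))
  <= ip (frame_var G h) (frame_var G h).
Proof.
move=> hG; have [s0 [K [/andP[s0_gt0 s0_le1] exp_h]]] := local_expansion hG.
have DA := first_order hG; set A := frame_var G h in exp_h DA *.
have Dh i : rdot (D *m G i) (h i) = 0.
  by rewrite critical rdotZl (rdotC (G i)) hG mulr0.
rewrite -subr_ge0; apply: (@limit_ge0 _ (ip A A + 2 * K) _ s0_gt0).
move=> s s_gt0 s_le; have [X [XK pos /(_ Dh) DX]] := exp_h s s_gt0 s_le.
rewrite DA DX mulr0 add0r in pos.
set Q := (X in 2 * X).
have QE : Q = \sum_i (rdot (D *m h i) (h i) - rdot (h i) (h i) / a i * rdot (D *m G i) (G i)).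
  by apply: eq_bigr => i _; congr (_ - _); rewrite mulrC mulrCA mulrC.
rewrite -QE in pos.
by apply: second_order_bound pos; rewrite ?ip_ge0 ?ip_AMGM // s_gt0 (le_trans s_le).
Qed.
End Local.

(** * Common orthonormal eigenbases *)

(** The second condition is the resolution of the identity; it replaces a
    separate argument that [d] orthonormal vectors span. *)
Definition orthonormal_basis (d : nat) (e : 'I_d -> 'cV[C]_d) : Prop :=
  (forall l m, cdot (e l) (e m) = (l == m)%:R) /\
  \sum_l outer (e l) (e l) = 1%:M.

(** Commuting hermitian matrices are the real and imaginary parts of a normal
    matrix, so both are diagonalized by the spectral theorem for [A + 'i *: B]. *)
Lemma commuting_hermitian_eigenbasis (d : nat) (A B : 'M[C]_d) :
    adjmx A = A -> adjmx B = B -> A *m B = B *m A ->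
  exists e : 'I_d -> 'cV[C]_d, exists alpha beta : 'I_d -> R,
    [/\ orthonormal_basis e, forall l, A *m e l = (alpha l)%:C *: e l
      & forall l, B *m e l = (beta l)%:C *: e l].
Proof.
move=> hA hB AB.
pose N := A + 'i *: B.
have adjN : adjmx N = A - 'i *: B by rewrite adjmxD adjmxZ conjCi scaleNr hA hB.
have N_normal : N \is normalmx.
  apply/normalmxP; rewrite -/(adjmx N) adjN /N.
  rewrite !(mulmxDl, mulmxDr, mulmxN, mulNmx) -!scalemxAl -!scalemxAr AB.
  by rewrite !addrA addrNK addrK.
have /orthomx_spectralP NE := N_normal.
set P := spectralmx N in NE; set sp := spectral_diag N in NE.
have P_unit : P \is unitarymx := spectral_unitarymx N.
have PV : invmx P = adjmx P by exact: invmx_unitary.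
have PPa : P *m adjmx P = 1%:M by apply/unitarymxP.
have PaP : adjmx P *m P = 1%:M by exact: mulmx1C.
exists (fun l => col l (adjmx P)), (fun l => Re (sp 0 l)), (fun l => complex.Im (sp 0 l)).
have adjNE : adjmx N = adjmx P *m diag_mx (map_mx Num.conj sp) *m P.
  rewrite {1}NE PV !adjmxM adjmxK mulmxA; congr (_ *m _ *m _).
  by rewrite /adjmx tr_diag_mx map_diag_mx.
have col_eigen (D : 'rV[C]_d) l :
    adjmx P *m diag_mx D *m P *m col l (adjmx P) = D 0 l *: col l (adjmx P).
  rewrite colE -!mulmxA [P *m _]mulmxA PPa mul1mx scalemxAr; congr (_ *m _).
  rewrite -colE; apply/colP => i; rewrite !mxE eqxx andbT.
  by case: eqVneq => [->|_]; rewrite ?mulr1 ?mulr0 ?mulr1n.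
have Ne l : N *m col l (adjmx P) = sp 0 l *: col l (adjmx P).
  by rewrite NE PV col_eigen.
have aNe l : adjmx N *m col l (adjmx P) = (sp 0 l)^* *: col l (adjmx P).
  by rewrite adjNE col_eigen mxE.
have two_neq0 : (2 : C) != 0 by rewrite pnatr_eq0.
have AE : A = 2^-1 *: (N + adjmx N).
  by rewrite adjN /N addrACA subrr addr0 -mulr2n -(scaler_nat _ A) scalerA mulVf ?scale1r.
have BE : B = (2 * 'i)^-1 *: (N - adjmx N).
  rewrite adjN /N opprD opprK addrACA subrr add0r -mulr2n -(scaler_nat _ ('i *: B)) !scalerA.
  by rewrite mulVf ?scale1r // mulf_neq0 ?neq0Ci.
split.
- split=> [l m|].
    have := congr1 (fun M : 'M[C]_d => M m l) PPa; rewrite !mxE eq_sym => <-.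
    by rewrite /cdot; apply: eq_bigr => j _; rewrite !mxE conjCK mulrC.
  rewrite -PaP; apply/matrixP => i j; rewrite summxE mxE; apply: eq_bigr => l _.
  by rewrite mxE big_ord1 !mxE conjCK.
- move=> l; rewrite {1}AE -scalemxAl mulmxDl Ne aNe -scalerDl scalerA.
  congr (_ *: _).
  have -> : sp 0 l + (sp 0 l)^* = 2 * (Re (sp 0 l))%:C := addcJ (sp 0 l).
  by rewrite mulKf.
- move=> l; rewrite {1}BE -scalemxAl mulmxBl Ne aNe -scalerBl scalerA.
  congr (_ *: _).
  have -> : sp 0 l - (sp 0 l)^* = 2 * (complex.Im (sp 0 l))%:C * 'i.
    by rewrite -complexiE; exact: subcJ (sp 0 l).
  by rewrite [in X in _ * X]mulrAC mulKf // mulf_neq0 ?neq0Ci.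
Qed.

(** * Expansions in an orthonormal basis *)

Section Basis.
Variables (d : nat) (e : 'I_d -> 'cV[C]_d).
Hypothesis e_basis : orthonormal_basis e.

Lemma basis_perm (s : {perm 'I_d}) : orthonormal_basis (fun l => e (s l)).
Proof.
have [e_orth e_full] := e_basis; split=> [l m|]; first by rewrite e_orth (inj_eq perm_inj).
by rewrite -e_full [RHS](reindex_inj (@perm_inj _ s)).
Qed.

Lemma basis_expand (x : 'cV[C]_d) : x = \sum_l cdot x (e l) *: e l.
Proof.
have [_ e_full] := e_basis.
by rewrite -{1}[x]mul1mx -e_full mulmx_suml; apply: eq_bigr => l _; rewrite outerE.
Qed.

Lemma cdot_basis (x y : 'cV[C]_d) : cdot x y = \sum_l cdot x (e l) * (cdot y (e l))^*.
Proof.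
rewrite {1}[x]basis_expand cdot_suml; apply: eq_bigr => l _.
by rewrite cdotZl (cdotC y).
Qed.

Lemma rdot_basis (x : 'cV[C]_d) : rdot x x = \sum_l nsq (cdot x (e l)).
Proof. by rewrite /rdot cdot_basis Re_sum. Qed.

Lemma ip_basis (A B : 'M[C]_d) : ip A B = \sum_l rdot (B *m e l) (A *m e l).
Proof.
have [_ e_full] := e_basis.
rewrite -{1}[B]mulmx1 -e_full mulmx_sumr ip_sumr; apply: eq_bigr => l _.
by rewrite mul_outer ip_outer.
Qed.

Lemma basis_norm1 l : rdot (e l) (e l) = 1.
Proof. by have [e_orth _] := e_basis; rewrite /rdot e_orth eqxx. Qed.

End Basis.

(** * Inequalities between spectra *)

Lemma sorting_perm (n : nat) (f : 'I_n -> R) :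
  exists s : {perm 'I_n}, forall i j : 'I_n, (i <= j)%N -> f (s j) <= f (s i).
Proof.
pose r (i j : 'I_n) := f j <= f i.
have r_total : total r by move=> i j; rewrite /r le_total.
have r_trans : transitive r by move=> j i l ij jl; apply: le_trans jl ij.
pose t := sort r (enum 'I_n).
have t_size : size t = n by rewrite size_sort size_enum_ord.
have t_uniq : uniq t by rewrite sort_uniq enum_uniq.
pose g (i : 'I_n) := nth i t i.
have g_inj : injective g.
  move=> i j; rewrite /g (set_nth_default i j) ?t_size // => /eqP.
  by rewrite nth_uniq ?t_size // => /eqP /val_inj.
exists (perm g_inj) => i j ij; rewrite !permE /g (set_nth_default i j) ?t_size //.
have r_refl : reflexive r by move=> l; exact: lexx.
by apply: (sorted_leq_nth r_trans r_refl); rewrite ?inE ?t_size // sort_sorted.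
Qed.

Lemma sum_lt_const (n : nat) (j : 'I_n) (c : R) :
  \sum_(l : 'I_n | (l < j)%N) c = j%:R * c.
Proof.
rewrite -(big_ord_widen n (fun=> c : R) (ltnW (ltn_ord j))).
by rewrite sumr_const card_ord mulr_natl.
Qed.

(** Weights in [0, 1] of total mass at most [j] do best when they sit on the [j]
    largest values: compare [nu] with its value at the threshold [j]. *)
Lemma weighted_sum_le (n : nat) (nu w : 'I_n -> R) (j : 'I_n) :
    (forall l m : 'I_n, (l <= m)%N -> nu m <= nu l) -> 0 <= nu j ->
    (forall l, 0 <= w l <= 1) -> \sum_l w l <= j%:R ->
  \sum_l w l * nu l <= \sum_(l : 'I_n | (l < j)%N) nu l.
Proof.
move=> nu_sorted nu_ge0 w01 w_sum.
have key : \sum_l w l * (nu l - nu j) <= \sum_(l : 'I_n | (l < j)%N) (nu l - nu j).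
  rewrite [leRHS]big_mkcond; apply: ler_sum => l _ /=.
  have /andP[w0 w1] := w01 l.
  case: ltnP => lj; first by rewrite ler_piMl // subr_ge0 nu_sorted // ltnW.
  by rewrite mulr_ge0_le0 // subr_le0 nu_sorted.
have E1 : \sum_l w l * (nu l - nu j) = \sum_l w l * nu l - (\sum_l w l) * nu j.
  by rewrite mulr_suml -sumrB; apply: eq_bigr => l _; rewrite mulrBr.
have E2 : \sum_(l : 'I_n | (l < j)%N) (nu l - nu j) =
          \sum_(l : 'I_n | (l < j)%N) nu l - j%:R * nu j.
  by rewrite sumrB sum_lt_const.
have := ler_wpM2r nu_ge0 w_sum; rewrite E1 E2 in key; lra.
Qed.

(** Summation by parts, with a vanishing boundary term. *)
Lemma partial_sums_le (n : nat) (delta x : 'I_n -> R) :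
    (forall i j : 'I_n, j = i.+1 :> nat ->
       (delta i - delta j) * \sum_(l : 'I_n | (l < j)%N) x l <= 0) ->
    \sum_l x l = 0 -> \sum_l delta l * x l <= 0.
Proof.
case: n delta x => [|n] delta x; first by rewrite !big_ord0.
suff main : (forall i j : 'I_n.+1, j = i.+1 :> nat ->
       (delta i - delta j) * \sum_(l : 'I_n.+1 | (l < j)%N) x l <= 0) ->
    \sum_l delta l * x l <= delta ord_max * \sum_l x l.
  by move=> /main h x0; rewrite x0 mulr0 in h.
elim: n delta x => [|n IHn] delta x hyp.
  by rewrite !big_ord1 (ord1 ord_max).
pose W := widen_ord (leqnSn n.+1).
have restrict (F : 'I_n.+2 -> R) (j : nat) : (j <= n.+1)%N ->
    \sum_(l : 'I_n.+2 | (l < j)%N) F l = \sum_(l : 'I_n.+1 | (l < j)%N) F (W l).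
  move=> jn; rewrite big_mkcond big_ord_recr /= ltnNge jn addr0.
  by rewrite [RHS]big_mkcond.
rewrite big_ord_recr [in leRHS]big_ord_recr /=.
have IH : \sum_(l < n.+1) delta (W l) * x (W l) <= delta (W ord_max) * \sum_l x (W l).
  apply: (IHn (delta \o W) (x \o W)) => i j ij /=.
  by have := hyp (W i) (W j) ij; rewrite /= restrict // ltnW.
have := hyp (W ord_max) ord_max erefl; rewrite restrict //=.
under eq_bigl do rewrite ltn_ord.
move: IH; rewrite -/W; set Sx := \sum_l x (W l); set Sd := \sum_l _; lra.
Qed.

Lemma nsq_cdotC (d : nat) (x y : 'cV[C]_d) : nsq (cdot x y) = nsq (cdot y x).
Proof. by rewrite cdotC nsq_conj. Qed.

(** Von Neumann's trace inequality.  The squared moduli [P l m] of the entries of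
    the change of basis are doubly stochastic, so the inner product is
    [\sum_l lambda l * nu' l] with [nu'] an average of [nu]; the partial sums of
    [nu'] are at most those of [nu], and [lambda] is decreasing. *)
Lemma trace_product_le (d : nat) (S T : 'M[C]_d) (e f : 'I_d -> 'cV[C]_d)
    (lambda nu : 'I_d -> R) :
    orthonormal_basis e -> orthonormal_basis f ->
    (forall l, S *m e l = (lambda l)%:C *: e l) ->
    (forall m, T *m f m = (nu m)%:C *: f m) ->
    adjmx S = S ->
    (forall l m : 'I_d, (l <= m)%N -> lambda m <= lambda l) ->
    (forall l m : 'I_d, (l <= m)%N -> nu m <= nu l) ->
    (forall m, 0 <= nu m) ->
  ip S T <= \sum_l lambda l * nu l.
Proof.
move=> e_basis f_basis Se Tf S_herm lambda_sorted nu_sorted nu_ge0.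
pose P l m := nsq (cdot (f m) (e l)).
have P_ge0 l m : 0 <= P l m by exact: nsq_ge0.
have P_row l : \sum_m P l m = 1.
  rewrite -(basis_norm1 e_basis l) (rdot_basis f_basis).
  by apply: eq_bigr => m _; rewrite nsq_cdotC.
have P_col m : \sum_l P l m = 1.
  by rewrite -(basis_norm1 f_basis m) (rdot_basis e_basis).
have ipE : ip S T = \sum_l lambda l * \sum_m P l m * nu m.
  rewrite (ip_basis f_basis).
  under [RHS]eq_bigr do rewrite mulr_sumr.
  rewrite exchange_big /=; apply: eq_bigr => m _.
  rewrite Tf rdotZl rdotC /rdot (cdot_basis e_basis) Re_sum mulr_sumr.
  apply: eq_bigr => l _.
  by rewrite cdot_adj S_herm Se cdotZr conj_real -mulrA ReZ -/(nsq _) -/(P l m); ring.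
rewrite ipE -subr_le0 -sumrB; under eq_bigr do rewrite -mulrBr.
apply: partial_sums_le => [i j ij|]; last first.
  rewrite sumrB exchange_big /=; under eq_bigr do rewrite -mulr_suml P_col mul1r.
  by rewrite subrr.
rewrite mulr_ge0_le0 //; first by rewrite subr_ge0 lambda_sorted // ij.
rewrite sumrB subr_le0 exchange_big /=.
under eq_bigr do rewrite -mulr_suml.
apply: weighted_sum_le => // [m|].
  rewrite sumr_ge0 //= -(P_col m) [leRHS](bigID (fun l : 'I_d => (l < j)%N)) /=.
  by rewrite lerDl sumr_ge0.
rewrite exchange_big /=; under eq_bigr do rewrite P_row.
by rewrite sum_lt_const mulr1.
Qed.

Section FrameSpectrum.
Variables (d k : nat) (H : 'I_k -> 'cV[C]_d) (f : 'I_d -> 'cV[C]_d) (nu : 'I_d -> R).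
Hypothesis f_basis : orthonormal_basis f.
Hypothesis Hf : forall m, frame_op H *m f m = (nu m)%:C *: f m.

Lemma cdot_frame_op x y :
  cdot (frame_op H *m x) y = \sum_i cdot x (H i) * cdot (H i) y.
Proof. by rewrite frame_opE cdot_suml; apply: eq_bigr => i _; rewrite cdotZl. Qed.

Lemma rdot_frame_op x : rdot (frame_op H *m x) x = \sum_i nsq (cdot x (H i)).
Proof.
rewrite /rdot cdot_frame_op Re_sum; apply: eq_bigr => i _.
by rewrite /nsq (cdotC x (H i)).
Qed.

Lemma frame_eigenvalue m : nu m = \sum_i nsq (cdot (H i) (f m)).
Proof.
have := rdot_frame_op (f m); rewrite Hf rdotZl basis_norm1 // mulr1 => ->.
by apply: eq_bigr => i _; rewrite nsq_cdotC.
Qed.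

Lemma frame_eigenvalue_ge0 m : 0 <= nu m.
Proof. by rewrite frame_eigenvalue sumr_ge0 // => i _; rewrite nsq_ge0. Qed.

Lemma frame_kernel m i : nu m = 0 -> cdot (H i) (f m) = 0.
Proof.
rewrite frame_eigenvalue => /eqP; rewrite psumr_eq0 => [/allP h|j _]; last exact: nsq_ge0.
by apply/eqP; rewrite -nsq_eq0; exact: h (mem_index_enum i).
Qed.

Lemma sum_eigenvalues : \sum_m nu m = \sum_i rdot (H i) (H i).
Proof.
under [RHS]eq_bigr do rewrite (rdot_basis f_basis).
by rewrite exchange_big; apply: eq_bigr => m _; rewrite frame_eigenvalue.
Qed.

Lemma ip_frame_op : ip (frame_op H) (frame_op H) = \sum_m nu m ^+ 2.
Proof.
rewrite (ip_basis f_basis); apply: eq_bigr => m _.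
by rewrite Hf rdotZl rdotZr basis_norm1 // mulr1.
Qed.

(** If [T = frame_op H] is invertible, the left side is the value at [H i] of the
    quadratic form of [T^-1]; it is at most [1] because [T] dominates
    [outer (H i) (H i)].  In general the convention [0^-1 = 0] replaces [T^-1] by
    the pseudo-inverse, and the [x] of the proof is the image of [H i] under it. *)
Lemma whitened_norm_le1 i : \sum_m nsq (cdot (H i) (f m)) / nu m <= 1.
Proof.
set s := \sum_m _.
pose x := \sum_m ((nu m)^-1%:C * cdot (H i) (f m)) *: f m.
have [f_orth _] := f_basis.
have xf m : cdot x (f m) = (nu m)^-1%:C * cdot (H i) (f m).
  rewrite /x cdot_suml (bigD1 m) //= cdotZl f_orth eqxx mulr1 big1 ?addr0 // => l lm.
  by rewrite cdotZl f_orth (negbTE lm) mulr0.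
have xH : cdot x (H i) = s%:C.
  rewrite (cdot_basis f_basis) rmorph_sum /=; apply: eq_bigr => m _.
  by rewrite xf -mulrA -nsqC -rmorphM mulrC.
have Txx : rdot (frame_op H *m x) x = s.
  rewrite /rdot (cdot_basis f_basis) Re_sum; apply: eq_bigr => m _.
  rewrite cdot_adj frame_op_herm Hf cdotZr conj_real -mulrA ReZ -/(nsq _) xf nsqM nsq_real.
  have [->|nu_neq0] := eqVneq (nu m) 0; first by rewrite invr0 mul0r mulr0.
  by field.
have s2 : s ^+ 2 <= s.
  rewrite -{2}Txx rdot_frame_op (bigD1 i) //= xH nsq_real lerDl sumr_ge0 // => l _.
  exact: nsq_ge0.
rewrite leNgt; apply/negP => s1.
have s_gt0 : 0 < s := lt_trans ltr01 s1.
by move: s2; rewrite expr2 ger_pMl // leNgt s1.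
Qed.

Hypothesis nu_sorted : forall l m : 'I_d, (l <= m)%N -> nu m <= nu l.

(** The easy half of the Schur-Horn theorem.  The norms over [J] are
    [\sum_m w m * nu m], where [w m] is the share of the vectors of [J] in the
    eigenvalue [nu m]; each share is at most [1], and by [whitened_norm_le1]
    their total is at most [#|J|]. *)
Lemma partial_norms_le (J : {set 'I_k}) (j : 'I_d) : (#|J| <= j)%N ->
  \sum_(i in J) rdot (H i) (H i) <= \sum_(m : 'I_d | (m < j)%N) nu m.
Proof.
move=> J_le.
pose w m := \sum_(i in J) nsq (cdot (H i) (f m)) / nu m.
have w_nu m : w m * nu m = \sum_(i in J) nsq (cdot (H i) (f m)).
  rewrite mulr_suml; apply: eq_bigr => i _.
  have [nu0|nu_neq0] := eqVneq (nu m) 0; last by rewrite divfK.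
  by rewrite nu0 mulr0 frame_kernel // nsqE /= expr0n addr0.
have -> : \sum_(i in J) rdot (H i) (H i) = \sum_m w m * nu m.
  under eq_bigr do rewrite (rdot_basis f_basis).
  by rewrite exchange_big; apply: eq_bigr => m _; rewrite w_nu.
apply: weighted_sum_le => // [|m|]; first exact: frame_eigenvalue_ge0.
- rewrite sumr_ge0 /= => [|i _]; last by rewrite divr_ge0 ?nsq_ge0 ?frame_eigenvalue_ge0.
  have [nu0|nu_neq0] := eqVneq (nu m) 0.
    by rewrite /w nu0 big1 ?ler01 // => i _; rewrite invr0 mulr0.
  have nu_gt0 : 0 < nu m by rewrite lt_def nu_neq0 frame_eigenvalue_ge0.
  rewrite -(ler_pM2r nu_gt0) w_nu mul1r [leRHS]frame_eigenvalue.
  rewrite [leRHS](bigID (mem J)) /= lerDl sumr_ge0 // => i _; exact: nsq_ge0.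
- rewrite exchange_big /=; apply: (@le_trans _ _ (\sum_(i in J) 1)).
    by apply: ler_sum => i _; exact: whitened_norm_le1.
  by rewrite sumr_const ler_nat.
Qed.
End FrameSpectrum.

(** * The spectrum at a local minimizer *)

(** More than [j] vectors in the span of the first [j] basis vectors are
    dependent; the coefficients come from the kernel of the matrix of
    coordinates. *)
Lemma linear_dependence (d k : nat) (g : 'I_k -> 'cV[C]_d) (e : 'I_d -> 'cV[C]_d)
    (J : {set 'I_k}) (j : 'I_d) :
    orthonormal_basis e -> (j < #|J|)%N ->
    (forall i (l : 'I_d), i \in J -> (j <= l)%N -> cdot (g i) (e l) = 0) ->
  exists z : 'I_k -> C,
    [/\ \sum_i z i *: g i = 0, forall i, i \notin J -> z i = 0 & exists i, z i != 0].
Proof.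
move=> e_basis J_gt g0.
pose W := widen_ord (ltnW (ltn_ord j)).
pose N : 'M[C]_(#|J|, j) := \matrix_(u, v) cdot (g (enum_val u)) (e (W v)).
have /rowV0Pn [v /sub_kermxP vN v_neq0] : kermx N != 0.
  by rewrite kermx_eq0 /row_free neq_ltn (leq_ltn_trans (rank_leq_col N)).
pose z i := \sum_(u | enum_val u == i) v 0 u.
have zE u : z (enum_val u) = v 0 u.
  by rewrite /z (big_pred1 u) // => u'; rewrite (inj_eq enum_val_inj).
have zJ i : i \notin J -> z i = 0.
  move=> iJ; rewrite /z big_pred0 // => u; apply/negbTE; apply: contra iJ => /eqP <-.
  exact: enum_valP.
exists z; split=> //; last first.
  by have /rV0Pn [u vu] := v_neq0; exists (enum_val u); rewrite zE.
have zg : \sum_i z i *: g i = \sum_u v 0 u *: g (enum_val u).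
  rewrite (bigID (mem J)) /= [X in _ + X]big1 ?addr0 => [|i iJ]; last by rewrite zJ ?scale0r.
  by rewrite big_enum_val; apply: eq_bigr => u _; rewrite zE.
rewrite zg [LHS](basis_expand e_basis) big1 // => l _.
rewrite cdot_suml; have [lj|jl] := ltnP l j; last first.
  by rewrite big1 ?scale0r // => u _; rewrite cdotZl g0 ?mulr0 // enum_valP.
have := congr1 (fun M : 'rV[C]_j => M 0 (Ordinal lj)) vN; rewrite !mxE => vNl.
rewrite (_ : \sum_u _ = 0) ?scale0r // -[RHS]vNl; apply: eq_bigr => u _.
by rewrite cdotZl mxE (_ : W _ = l) //; apply: val_inj.
Qed.

Section LocalSpectrum.
Variables (d k : nat) (S0 : 'M[C]_d) (a : 'I_k -> R) (G : 'I_k -> 'cV[C]_d).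
Hypothesis S0_herm : adjmx S0 = S0.
Hypothesis a_gt0 : forall i, 0 < a i.
Hypothesis G_min : local_minimizer a (Theta2 S0) G.
Variables (e : 'I_d -> 'cV[C]_d) (lambda mu : 'I_d -> R).
Hypothesis e_basis : orthonormal_basis e.
Hypothesis S0e : forall l, S0 *m e l = (lambda l)%:C *: e l.
Hypothesis Ge : forall l, frame_op G *m e l = (mu l)%:C *: e l.

Let D := S0 - frame_op G.
Let delta l := lambda l - mu l.
Let c i := rdot (D *m G i) (G i) / a i.

Lemma residual_eigen l : D *m e l = (delta l)%:C *: e l.
Proof. by rewrite mulmxBl S0e Ge -scalerBl -rmorphB. Qed.

Lemma residual_critical i : D *m G i = (c i)%:C *: G i.
Proof. exact: (critical S0_herm a_gt0 G_min). Qed.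

(** [G i] is an eigenvector of [D], so it is orthogonal to the eigenspaces of the
    other eigenvalues. *)
Lemma level_of_support i l : cdot (G i) (e l) != 0 -> c i = delta l.
Proof.
move=> gl; have := cdot_adj D (G i) (e l).
rewrite (residual_herm G S0_herm) residual_critical residual_eigen cdotZl cdotZr conj_real.
by move/(mulIf gl) => [].
Qed.

Lemma level_nsq i l : c i * nsq (cdot (G i) (e l)) = delta l * nsq (cdot (G i) (e l)).
Proof.
have [->|gl] := eqVneq (cdot (G i) (e l)) 0; last by rewrite (level_of_support gl).
by rewrite nsqE /= expr0n addr0 !mulr0.
Qed.

Lemma rdot_two (l m : 'I_d) (p q p' q' : C) : l != m ->
  rdot (p *: e l + q *: e m) (p' *: e l + q' *: e m) = Re (p * p'^* + q * q'^*).
Proof.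
move=> lm; have [e_orth _] := e_basis.
rewrite /rdot !(cdotDl, cdotDr, cdotZl, cdotZr) !e_orth !eqxx (negbTE lm).
by rewrite [m == l]eq_sym (negbTE lm) !mulr1n !mulr0n; congr (Re _); ring.
Qed.

(** The direction [h] turns the component of each [G i] on [e m] towards [e l]
    with speed [y], and the component on [e l] towards [- e m] with speed [x].
    It is tangent in two cases: if the speeds agree, since it is then a rotation
    of the whole frame, and if the eigenvalues of [D] differ, since each [G i] then
    has at most one of the two components.  The inequality is [second_order] for
    this direction. *)
Lemma two_plane_variation (l m : 'I_d) (x y : R) : l != m ->
    x = y \/ delta l != delta m ->
  (delta l - delta m) * (y ^+ 2 * mu m - x ^+ 2 * mu l) <= (y * mu m - x * mu l) ^+ 2.
Proof.
move=> lm xy; have [e_orth _] := e_basis.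
pose p i := cdot (G i) (e m); pose q i := cdot (G i) (e l).
pose h i := (y%:C * p i) *: e l + (- (x%:C * q i)) *: e m.
have hG i : rdot (h i) (G i) = 0.
  rewrite /h /rdot cdotDl !cdotZl [cdot (e l) _]cdotC [cdot (e m) _]cdotC.
  rewrite -/(p i) -/(q i) ReD mulNr ReN -!mulrA !ReZ.
  have -> : Re (q i * (p i)^*) = Re (p i * (q i)^*).
    by rewrite -complexRe_conj rmorphM /= conjCK mulrC.
  case: xy => [->|dlm]; first by rewrite subrr.
  have [p0|p0] := eqVneq (p i) 0; first by rewrite p0 mul0r !mulr0 subrr.
  have [q0|q0] := eqVneq (q i) 0; first by rewrite q0 rmorph0 mulr0 !mulr0 subrr.
  by rewrite -(level_of_support p0) -(level_of_support q0) eqxx in dlm.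
have := second_order S0_herm a_gt0 G_min hG.
have -> : frame_var G h = (y * mu m - x * mu l)%:C *: (outer (e l) (e m) + outer (e m) (e l)).
  have half u v : \sum_i outer (cdot (G i) (e u) *: e v) (G i) = (mu u)%:C *: outer (e v) (e u).
    transitivity (outer (e v) (frame_op G *m e u)).
      rewrite frame_opE outer_sumr; apply: eq_bigr => i _.
      by rewrite outerZl outerZr -cdotC.
    by rewrite Ge outerZr conj_real.
  have hE : \sum_i outer (h i) (G i) =
      (y * mu m)%:C *: outer (e l) (e m) - (x * mu l)%:C *: outer (e m) (e l).
    rewrite !rmorphM -!scalerA -!half !scaler_sumr -sumrB; apply: eq_bigr => i _.
    by rewrite /h !outerDl !outerZl scaleNr !scalerA.
  rewrite /frame_var big_split /= hE.
  have -> : \sum_i outer (G i) (h i) = adjmx (\sum_i outer (h i) (G i)).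
    by rewrite adjmx_sum; apply: eq_bigr => i _; rewrite adj_outer.
  rewrite hE adjmxD adjmxN !adjmxZ !adj_outer !conj_real rmorphB.
  move: (outer (e l) (e m)) (outer (e m) (e l)) (y * mu m) (x * mu l) => X Y b b'.
  by apply/matrixP => u v; rewrite !mxE; move: (X u v) (Y u v) => Xuv Yuv; ring.
rewrite ipZl ipZr.
have -> : ip (outer (e l) (e m) + outer (e m) (e l)) (outer (e l) (e m) + outer (e m) (e l)) = 2.
  rewrite ipDr !ip_outer !mulmxDl !outerE !e_orth !eqxx (negbTE lm) eq_sym (negbTE lm).
  by rewrite !scale0r !scale1r addr0 add0r !basis_norm1.
have -> : \sum_i (rdot (D *m h i) (h i) - c i * rdot (h i) (h i))
   = (delta l - delta m) * (y ^+ 2 * mu m - x ^+ 2 * mu l).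
  rewrite !(frame_eigenvalue e_basis Ge) !mulr_sumr -sumrB mulr_sumr.
  apply: eq_bigr => i _.
  have -> : D *m h i = ((delta l)%:C * (y%:C * p i)) *: e l
                       + ((delta m)%:C * - (x%:C * q i)) *: e m.
    by rewrite mulmxDr -!scalemxAr !residual_eigen !scalerA ![_ * (delta _)%:C]mulrC.
  rewrite !rdot_two // -(mulrA (delta l)%:C) -(mulrA (delta m)%:C) !ReD !ReZ -!/(nsq _).
  rewrite nsqN !nsqM !nsq_real.
  have Em := level_nsq i m; have El := level_nsq i l.
  rewrite -/(p i) in Em *; rewrite -/(q i) in El *.
  move: (nsq (p i)) (nsq (q i)) (c i) Em El => P Q ci Em El.
  rewrite mulrDr [ci * _]mulrCA [ci * (x ^+ 2 * _)]mulrCA Em El; ring.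
by move: (_ * (_ - _)) (y * mu m - _) => P Q; lra.
Qed.

(** Equal speeds turn [two_plane_variation] into
    [0 <= (lambda l - lambda m) * (mu l - mu m)]. *)
Lemma spectra_aligned l m : lambda l < lambda m -> mu l <= mu m.
Proof.
move=> lam; have [->//|lm] := eqVneq l m.
have := two_plane_variation (x := 1) (y := 1) lm (or_introl erefl).
rewrite /delta !expr1n !mul1r => h; rewrite leNgt; apply/negP => mlt.
have : 0 < (lambda m - lambda l) * (mu l - mu m) by rewrite mulr_gt0 ?subr_gt0.
lra.
Qed.

(** If [delta m < delta l], it would pay to increase the larger eigenvalue [mu l]
    at the expense of [mu m].  With speeds [mu l] and [mu m] the off-diagonal
    part of the variation cancels, which already settles the case
    [mu m < mu l]; speeding up slightly settles the case of equality as well. *)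
Lemma residual_eigenvalue_order l m :
  0 < mu m -> mu m <= mu l -> delta l <= delta m.
Proof.
move=> mu_gt0 mu_le; rewrite leNgt; apply/negP => dlt.
have dlm : delta l != delta m by rewrite gt_eqF.
have lm : l != m by apply: contraNneq dlm => ->.
(* A gain of first order in the extra speed beats the loss, of second order; the
   gap [delta l - delta m] itself is small enough. *)
have := two_plane_variation (x := mu m) (y := mu l + (delta l - delta m)) lm (or_intror dlm).
have : 0 < delta l - delta m by rewrite subr_gt0.
move: (delta l - delta m) (mu l) (mu m) mu_gt0 mu_le => t u v v_gt0 vu t_gt0 h.
have u_gt0 : 0 < u by lra.
have uv_gt0 : 0 < u * v by rewrite mulr_gt0.
have e1 : 0 <= t * (u * v) * (u - v) by rewrite !mulr_ge0 ?subr_ge0 // ltW.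
have e2 : 0 < t ^+ 2 * (u * v) by rewrite mulr_gt0 // exprn_gt0.
have e3 : 0 <= t ^+ 2 * v * (u - v) by rewrite !mulr_ge0 ?sqr_ge0 ?subr_ge0 // ltW.
have e4 : 0 < t ^+ 3 * v by rewrite mulr_gt0 // exprn_gt0.
lra.
Qed.

(** Moving each [G j] along [e l] by the conjugate of its coefficient in a
    dependence relation within one eigenspace of [D] leaves the frame operator fixed to first order.  Then
    [second_order] has a zero right side and forbids [e l] to have a larger
    eigenvalue than the vectors that move. *)
Lemma dependent_level_max (z : 'I_k -> C) i l :
  \sum_j z j *: G j = 0 -> z i != 0 -> delta l <= c i.
Proof.
move=> zG zi; have [e_orth _] := e_basis.
rewrite leNgt; apply/negP => cd.
(* The relation splits along the eigenspaces of [D]. *)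
pose z' j := if c j == c i then z j else 0.
have zG' : \sum_j z' j *: G j = 0.
  rewrite [LHS](basis_expand e_basis) big1 // => m _.
  rewrite cdot_suml; have [dm|dm] := eqVneq (delta m) (c i).
    rewrite (_ : \sum_j _ = 0) ?scale0r // -[RHS](cdot0l (e m)) -zG cdot_suml.
    apply: eq_bigr => j _; rewrite !cdotZl /z'.
    have [->|gm] := eqVneq (cdot (G j) (e m)) 0; first by rewrite !mulr0.
    by rewrite (level_of_support gm) dm eqxx.
  rewrite big1 ?scale0r // => j _; rewrite cdotZl /z'.
  have [->|gm] := eqVneq (cdot (G j) (e m)) 0; first by rewrite mulr0.
  by rewrite (level_of_support gm) (negbTE dm) mul0r.
pose h j := (z' j)^* *: e l.
have hG j : rdot (h j) (G j) = 0.
  rewrite /rdot cdotZl /z' [cdot (e l) _]cdotC.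
  case: eqVneq => [cj|_]; last by rewrite rmorph0 mul0r.
  have [->|gl] := eqVneq (cdot (G j) (e l)) 0; first by rewrite rmorph0 mulr0.
  by have := cd; rewrite -cj (level_of_support gl) ltxx.
have := second_order S0_herm a_gt0 G_min hG.
have -> : frame_var G h = 0.
  have hE : \sum_j outer (h j) (G j) = 0.
    transitivity (outer (e l) (\sum_j z' j *: G j)).
      by rewrite outer_sumr; apply: eq_bigr => j _; rewrite outerZl outerZr.
    by rewrite zG' /outer /adjmx trmx0 map_mx0 mulmx0.
  rewrite /frame_var big_split /= hE add0r.
  have -> : \sum_j outer (G j) (h j) = adjmx (\sum_j outer (h j) (G j)).
    by rewrite adjmx_sum; apply: eq_bigr => j _; rewrite adj_outer.
  by rewrite hE /adjmx trmx0 map_mx0.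
have -> : ip (0 : 'M[C]_d) 0 = 0 by rewrite /ip mulmx0 mxtrace0.
have -> : \sum_j (rdot (D *m h j) (h j) - c j * rdot (h j) (h j))
   = (delta l - c i) * \sum_j nsq (z' j).
  rewrite mulr_sumr; apply: eq_bigr => j _.
  rewrite -scalemxAr residual_eigen scalerA.
  rewrite mulrC -scalerA rdotZl -mulrBl.
  have -> : rdot (h j) (h j) = nsq (z' j).
    by rewrite /rdot cdotZl cdotZr e_orth eqxx conjCK mulr1 -(nsq_conj (z' j)) /nsq conjCK.
  by rewrite /z'; case: eqVneq => [->//|_]; rewrite nsqE /= expr0n addr0 !mulr0.
have z_gt0 : 0 < \sum_j nsq (z' j).
  rewrite (bigD1 i) //= ltr_wpDr //; first by rewrite sumr_ge0 // => j _; exact: nsq_ge0.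
  by rewrite lt_def nsq_ge0 nsq_eq0 /z' eqxx zi.
have : 0 < (delta l - c i) * \sum_j nsq (z' j) by rewrite mulr_gt0 ?subr_gt0.
by move: (_ * \sum_j _) => P; lra.
Qed.
End LocalSpectrum.

(** * Comparison with an arbitrary point of the torus *)

Section Comparison.
Variables (d k : nat) (S0 : 'M[C]_d) (a : 'I_k -> R) (G : 'I_k -> 'cV[C]_d).
Hypothesis S0_herm : adjmx S0 = S0.
Hypothesis a_gt0 : forall i, 0 < a i.
Hypothesis G_min : local_minimizer a (Theta2 S0) G.

Lemma frame_op_commutes : S0 *m frame_op G = frame_op G *m S0.
Proof.
set D := S0 - frame_op G.
have DS : D *m frame_op G = frame_op G *m D.
  rewrite mulmx_sumr mulmx_suml; apply: eq_bigr => i _.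
  rewrite mul_outer outer_mul (residual_herm G S0_herm) (critical S0_herm a_gt0 G_min).
  by rewrite outerZl outerZr conj_real.
by rewrite -(subrK (frame_op G) S0) -/D mulmxDl mulmxDr DS.
Qed.

(** Aligned spectra are both decreasing as soon as their sum is. *)
Lemma sorted_common_eigenbasis :
  exists e : 'I_d -> 'cV[C]_d, exists lambda mu : 'I_d -> R,
  [/\ orthonormal_basis e, forall l, S0 *m e l = (lambda l)%:C *: e l,
      forall l, frame_op G *m e l = (mu l)%:C *: e l,
      forall l m : 'I_d, (l <= m)%N -> lambda m <= lambda l
    & forall l m : 'I_d, (l <= m)%N -> mu m <= mu l].
Proof.
have [e [lambda [mu [e_basis S0e Ge]]]] :=
  commuting_hermitian_eigenbasis S0_herm (frame_op_herm G) frame_op_commutes.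
have [s s_sorted] := sorting_perm (fun l => lambda l + mu l).
have aligned := spectra_aligned S0_herm a_gt0 G_min e_basis S0e Ge.
exists (fun l => e (s l)), (fun l => lambda (s l)), (fun l => mu (s l)).
split=> [|l|l|l m lm|l m lm]; [exact: basis_perm|exact: S0e|exact: Ge| |];
  have := s_sorted l m lm => sum_le; rewrite leNgt; apply/negP => lt.
- by have := aligned _ _ lt; lra.
- have lt' : lambda (s m) < lambda (s l) by lra.
  by have := aligned _ _ lt'; lra.
Qed.

Variables (e : 'I_d -> 'cV[C]_d) (lambda mu : 'I_d -> R).
Hypothesis e_basis : orthonormal_basis e.
Hypothesis S0e : forall l, S0 *m e l = (lambda l)%:C *: e l.
Hypothesis Ge : forall l, frame_op G *m e l = (mu l)%:C *: e l.
Hypothesis lambda_sorted : forall l m : 'I_d, (l <= m)%N -> lambda m <= lambda l.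
Hypothesis mu_sorted : forall l m : 'I_d, (l <= m)%N -> mu m <= mu l.

Variables (H : 'I_k -> 'cV[C]_d) (f : 'I_d -> 'cV[C]_d) (nu : 'I_d -> R).
Hypothesis H_torus : in_torus a H.
Hypothesis f_basis : orthonormal_basis f.
Hypothesis Hf : forall m, frame_op H *m f m = (nu m)%:C *: f m.
Hypothesis nu_sorted : forall l m : 'I_d, (l <= m)%N -> nu m <= nu l.

Let delta l := lambda l - mu l.
Let c i := rdot ((S0 - frame_op G) *m G i) (G i) / a i.

Lemma torus_norms i : rdot (G i) (G i) = a i /\ rdot (H i) (H i) = a i.
Proof. by have [Ga _] := G_min; rewrite -!cnorm_sqr Ga H_torus. Qed.

Lemma support_eigenvalue_gt0 i l : cdot (G i) (e l) != 0 -> 0 < mu l.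
Proof.
move=> gl; rewrite lt_def (frame_eigenvalue_ge0 e_basis Ge) andbT.
by apply: contraNneq gl => /(frame_kernel e_basis Ge) ->.
Qed.

(** The set [J] collects the vectors in the eigenspaces of [D] up to [delta i];
    they are exactly those with a component on the first [j] basis vectors. *)
Lemma rising_step (i j : 'I_d) : j = i.+1 :> nat -> delta i < delta j ->
  \sum_(l : 'I_d | (l < j)%N) mu l <= \sum_(l : 'I_d | (l < j)%N) nu l.
Proof.
move=> ij dij.
have order := residual_eigenvalue_order S0_herm a_gt0 G_min e_basis S0e Ge.
have level := level_of_support S0_herm a_gt0 G_min S0e Ge.
have mu_ge0 := frame_eigenvalue_ge0 e_basis Ge.
have le_ij : (i <= j)%N by rewrite ij.
have mu_i_gt0 : 0 < mu i.
  rewrite lt_def mu_ge0 andbT; apply/eqP => mu_i0.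
  have mu_j0 : mu j = 0 by apply: le_anti; rewrite mu_ge0 -mu_i0 mu_sorted.
  by move: dij; rewrite /delta mu_i0 mu_j0 !subr0 ltNge lambda_sorted.
pose J := [set t | c t <= delta i].
have J_le : (#|J| <= j)%N.
  rewrite leqNgt; apply/negP => J_gt.
  have g0 t (l : 'I_d) : t \in J -> (j <= l)%N -> cdot (G t) (e l) = 0.
    rewrite inE => tJ jl; apply/eqP; apply: contraTT tJ => gl.
    rewrite -ltNge /c (level _ _ gl); apply: lt_le_trans dij _.
    by apply: order (mu_sorted jl); exact: support_eigenvalue_gt0 gl.
  have [z [zG zJ [t zt]]] := linear_dependence e_basis J_gt g0.
  have : t \in J by apply: contraNT zt => /zJ ->.
  rewrite inE leNgt => /negP; apply; apply: lt_le_trans dij _.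
  exact: (dependent_level_max S0_herm a_gt0 G_min e_basis S0e Ge j zG zt).
have J_supp (l : 'I_d) t : (l < j)%N -> t \notin J -> nsq (cdot (G t) (e l)) = 0.
  rewrite ij ltnS => li tJ; apply/eqP; rewrite nsq_eq0; apply: contraNT tJ => gl.
  by rewrite inE /c (level _ _ gl); apply: order mu_i_gt0 (mu_sorted li).
apply: le_trans (partial_norms_le f_basis Hf nu_sorted J_le).
have -> : \sum_(t in J) rdot (H t) (H t) = \sum_(t in J) \sum_l nsq (cdot (G t) (e l)).
  by apply: eq_bigr => t _; have [<- ->] := torus_norms t; rewrite (rdot_basis e_basis).
rewrite exchange_big /= [leRHS](bigID (fun l : 'I_d => (l < j)%N)) /=.
rewrite ler_wpDr ?sumr_ge0 // => [l _|]; first by rewrite sumr_ge0 // => t _; exact: nsq_ge0.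
apply: ler_sum => l lj; rewrite (frame_eigenvalue e_basis Ge) (bigID (mem J)) /=.
by rewrite [X in _ + X]big1 ?addr0 // => t tJ; exact: J_supp.
Qed.

(** By [residual_eigenvalue_order] the eigenvalue [mu j] vanishes, so the trace of
    [frame_op G] is already exhausted. *)
Lemma falling_step (i j : 'I_d) : j = i.+1 :> nat -> delta j < delta i ->
  \sum_(l : 'I_d | (l < j)%N) nu l <= \sum_(l : 'I_d | (l < j)%N) mu l.
Proof.
move=> ij dij.
have mu_ge0 := frame_eigenvalue_ge0 e_basis Ge.
have le_ij : (i <= j)%N by rewrite ij.
have mu_j0 : mu j = 0.
  apply/eqP; apply: contraTT dij => mu_j; rewrite -leNgt.
  apply: (residual_eigenvalue_order S0_herm a_gt0 G_min e_basis S0e Ge) (mu_sorted le_ij).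
  by rewrite lt_def mu_j mu_ge0.
have mu_total : \sum_(l : 'I_d | (l < j)%N) mu l = \sum_l mu l.
  rewrite [RHS](bigID (fun l : 'I_d => (l < j)%N)) /= [X in _ + X]big1 ?addr0 // => l.
  rewrite -leqNgt => jl; apply: le_anti.
  by rewrite mu_ge0 -mu_j0 mu_sorted.
rewrite mu_total (sum_eigenvalues e_basis Ge).
have -> : \sum_i rdot (G i) (G i) = \sum_i rdot (H i) (H i).
  by apply: eq_bigr => t _; have [-> ->] := torus_norms t.
rewrite -(sum_eigenvalues f_basis Hf) [leRHS](bigID (fun l : 'I_d => (l < j)%N)) /=.
by rewrite lerDl sumr_ge0 // => l _; exact: (frame_eigenvalue_ge0 f_basis Hf).
Qed.

Lemma spectral_variation_le0 : \sum_l delta l * (nu l - mu l) <= 0.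
Proof.
apply: partial_sums_le => [i j ij|]; last first.
  rewrite sumrB (sum_eigenvalues f_basis Hf) (sum_eigenvalues e_basis Ge).
  rewrite -sumrB big1 // => t _.
  by have [-> ->] := torus_norms t; rewrite subrr.
rewrite sumrB; case: (ltgtP (delta i) (delta j)) => [dij|dij|->].
- by rewrite mulr_le0_ge0 // ?subr_le0 ?subr_ge0 ?(ltW dij) // (rising_step ij dij).
- by rewrite mulr_ge0_le0 // ?subr_le0 ?subr_ge0 ?(ltW dij) // (falling_step ij dij).
- by rewrite subrr mul0r.
Qed.

(** The squared distances differ by at least
    [\sum_l (nu l - mu l) ^+ 2 - 2 * \sum_l delta l * (nu l - mu l)]. *)
Lemma residual_norm_le :
  ip (S0 - frame_op G) (S0 - frame_op G) <= ip (S0 - frame_op H) (S0 - frame_op H).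
Proof.
have expand A : ip (S0 - A) (S0 - A) = ip S0 S0 - 2 * ip S0 A + ip A A.
  rewrite !(ipDl, ipDr, ipNl, ipNr) (ipC A S0).
  by move: (ip S0 S0) (ip S0 A) (ip A A) => *; ring.
have S0G : ip S0 (frame_op G) = \sum_l lambda l * mu l.
  rewrite (ip_basis e_basis); apply: eq_bigr => l _.
  by rewrite Ge S0e rdotZl rdotZr (basis_norm1 e_basis); ring.
have S0H : ip S0 (frame_op H) <= \sum_l lambda l * nu l.
  apply: trace_product_le e_basis f_basis S0e Hf S0_herm lambda_sorted nu_sorted _.
  exact: (frame_eigenvalue_ge0 f_basis Hf).
rewrite !expand S0G (ip_frame_op e_basis Ge) (ip_frame_op f_basis Hf).
have : 0 <= \sum_l (nu l - mu l) ^+ 2 by rewrite sumr_ge0 // => l _; exact: sqr_ge0.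
have -> : \sum_l (nu l - mu l) ^+ 2 =
   \sum_l nu l ^+ 2 - 2 * (\sum_l lambda l * nu l) - \sum_l mu l ^+ 2
   + 2 * (\sum_l lambda l * mu l) + 2 * \sum_l delta l * (nu l - mu l).
  rewrite !mulr_sumr -!sumrB -!big_split /=; apply: eq_bigr => l _; rewrite /delta; ring.
have := spectral_variation_le0.
move: S0H; move: (ip S0 S0) (ip S0 _) (\sum_l lambda l * nu l) (\sum_l lambda l * mu l).
move: (\sum_l _ * (_ - _)) (\sum_l nu l ^+ 2) (\sum_l mu l ^+ 2) => x1 x2 x3 x4 x5 x6 x7.
lra.
Qed.
End Comparison.

Lemma local_minimizer_global (d k : nat) (S0 : 'M[C]_d) (a : 'I_k -> R)
    (G : 'I_k -> 'cV[C]_d) :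
  adjmx S0 = S0 -> (forall i, 0 < a i) ->
  local_minimizer a (Theta2 S0) G -> global_minimizer a (Theta2 S0) G.
Proof.
move=> S0_herm a_gt0 G_min; split=> [|H H_torus]; first by case: G_min.
have [e [lambda [mu [e_basis S0e Ge lambda_sorted mu_sorted]]]] :=
  sorted_common_eigenbasis S0_herm a_gt0 G_min.
have [f [nu [_ [f_basis Hf _]]]] :=
  commuting_hermitian_eigenbasis (frame_op_herm H) (frame_op_herm H) erefl.
have [s nu_sorted] := sorting_perm nu.
rewrite Theta2_le.
exact: (residual_norm_le S0_herm a_gt0 G_min e_basis S0e Ge lambda_sorted mu_sorted
         H_torus (basis_perm f_basis s) (fun m => Hf (s m)) nu_sorted).
Qed.

End LocalMinimizers.

Theorem theorem5p4 (R : realType) (d k : nat) (S0 : 'M[R[i]]_d) (a : 'I_k -> R)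
    (S0_psd : psdmx S0)
    (a_noninc : forall i j : 'I_k, (i <= j)%N -> a j <= a i)
    (a_pos : forall i : 'I_k, 0 < a i)
    (G : 'I_k -> 'cV[R[i]]_d) :
  local_minimizer a (Theta2 S0) G -> global_minimizer a (Theta2 S0) G.
Proof. by case: S0_psd => S0_herm _; exact: local_minimizer_global. Qed.
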